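(* For every $n\ge1$, the number of conjugacy classes of involutions in the finite Coxeter group of type $\mathtt A_n$ is $$\mathrm{cc}_2(W_{\mathtt A_n})=\begin{cases}k,&\text{if }n=2k,\\ k+1,&\text{if }n=2k+1,\end{cases}$$ and, for every $n\ge2$, in type $\mathtt C_n$ ($=\mathtt B_n$) it is $$\mathrm{cc}_2(W_{\mathtt C_n})=\begin{cases}k^2+2k,&\text{if }n=2k,\\ k^2+3k+1,&\text{if }n=2k+1.\end{cases}$$
   Context: $W_\Gamma$ denotes the Coxeter group with Coxeter diagram $\Gamma$ (vertices are the generators, which are involutions; non-adjacent generators commute; an unlabeled edge means the product has order $3$, an edge labeled $m$ means the product has order $m$). $\mathrm{cc}_2(W)$ is the number of conjugacy classes of elements of order exactly $2$ in $W$. The diagram $\mathtt A_n$ ($n\ge1$) is a path on $n$ vertices with all edges unlabeled. The diagram $\mathtt C_n=\mathtt B_n$ ($n\ge2$) is a path on $n$ vertices whose last edge is labeled $4$ and whose other edges are unlabeled. *)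

(* Defs.v *)
From HB Require Import structures.
From mathcomp Require Import all_boot all_fingroup.
From mathcomp Require Import generic_quotient boolp classical_sets cardinality.
Set Implicit Arguments.
Unset Strict Implicit.
Unset Printing Implicit Defensive.

Local Open Scope classical_set_scope.
Local Open Scope group_scope.
Local Open Scope quotient_scope.

(* A Coxeter diagram with vertex set I, encoded by its Coxeter matrix:
   the entry is 1 on the diagonal, 2 for non-adjacent vertices, 3 for an
   unlabeled edge, m for an edge labeled m, and 0 for an edge labeled oo
   (the relation (s_i s_j)^0 = 1 is void). *)
Record coxeter_matrix (I : Type) := CoxeterMatrix {
  coxeter_entry :> I -> I -> nat;
  coxeter_entry_sym : forall i j, coxeter_entry i j = coxeter_entry j i;
  coxeter_entry_eq1 : forall i j, coxeter_entry i j = 1%N <-> i = j }.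

Section CoxeterGroup.
Context {I : choiceType} (m : coxeter_matrix I).

(* The congruence on words generated by (s_i s_j)^(m i j) = 1; since m i i = 1,
   the generators are involutions, so the monoid presented in this way is the
   group with this presentation. *)
Inductive coxeter_equiv : seq I -> seq I -> Prop :=
| coxeter_equiv_rel u v i j :
    coxeter_equiv (u ++ flatten (nseq (m i j) [:: i; j]) ++ v) (u ++ v)
| coxeter_equiv_refl u : coxeter_equiv u u
| coxeter_equiv_sym u v : coxeter_equiv u v -> coxeter_equiv v u
| coxeter_equiv_trans u v w :
    coxeter_equiv u v -> coxeter_equiv v w -> coxeter_equiv u w.

Definition coxeter_equivb : rel (seq I) := fun u v => `[< coxeter_equiv u v >].

Lemma coxeter_equivb_refl : reflexive coxeter_equivb.
Proof. by move=> u; apply/asboolP; exact: coxeter_equiv_refl. Qed.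

Lemma coxeter_equivb_sym : symmetric coxeter_equivb.
Proof. by move=> u v; apply: asbool_equiv_eq; split; exact: coxeter_equiv_sym. Qed.

Lemma coxeter_equivb_trans : transitive coxeter_equivb.
Proof.
move=> v u w /asboolP uv /asboolP vw; apply/asboolP.
exact: coxeter_equiv_trans uv vw.
Qed.

Canonical coxeter_equiv_rel_struct :=
  EquivRel coxeter_equivb coxeter_equivb_refl coxeter_equivb_sym
    coxeter_equivb_trans.

Definition coxeter_group := {eq_quot coxeter_equivb}.

HB.instance Definition _ := Choice.on coxeter_group.
HB.instance Definition _ := EqQuotient.on coxeter_group.

Lemma coxeter_group_eqP (u v : seq I) :
  \pi_coxeter_group u = \pi_coxeter_group v <-> coxeter_equiv u v.
Proof.
by split=> [/eqmodP/asboolP|uv] //; apply/eqmodP/asboolP.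
Qed.

Lemma coxeter_equiv_cat u u' v v' :
  coxeter_equiv u u' -> coxeter_equiv v v' -> coxeter_equiv (u ++ v) (u' ++ v').
Proof.
move=> uu' vv'; apply: (@coxeter_equiv_trans _ (u' ++ v)).
  elim: uu' => {u u'} [a b i j|a|a b _ ih|a b c _ ih1 _ ih2].
  - by rewrite -!catA; exact: coxeter_equiv_rel.
  - exact: coxeter_equiv_refl.
  - exact: coxeter_equiv_sym.
  - exact: coxeter_equiv_trans ih1 ih2.
elim: vv' => {v v'} [a b i j|a|a b _ ih|a b c _ ih1 _ ih2].
- by rewrite !(catA u'); exact: coxeter_equiv_rel.
- exact: coxeter_equiv_refl.
- exact: coxeter_equiv_sym.
- exact: coxeter_equiv_trans ih1 ih2.
Qed.

Lemma coxeter_equiv_double u v i :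
  coxeter_equiv (u ++ [:: i, i & v]) (u ++ v).
Proof.
have := coxeter_equiv_rel u v i i.
by rewrite (coxeter_entry_eq1 m i i).2.
Qed.

Lemma coxeter_equiv_catV u : coxeter_equiv (u ++ rev u) [::].
Proof.
elim/last_ind: u => [|u i ih]; first exact: coxeter_equiv_refl.
rewrite rev_rcons cat_rcons.
exact: coxeter_equiv_trans (coxeter_equiv_double u (rev u) i) ih.
Qed.

Lemma coxeter_equiv_rev u v :
  coxeter_equiv u v -> coxeter_equiv (rev u) (rev v).
Proof.
move=> uv; apply: (@coxeter_equiv_trans _ (rev u ++ (v ++ rev v))).
  rewrite -[X in coxeter_equiv X]cats0.
  by apply: coxeter_equiv_cat; [exact: coxeter_equiv_refl|
    exact/coxeter_equiv_sym/coxeter_equiv_catV].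
rewrite catA -[X in coxeter_equiv _ X]cat0s.
apply: coxeter_equiv_cat; last exact: coxeter_equiv_refl.
apply: (@coxeter_equiv_trans _ (rev u ++ u)).
  by apply: coxeter_equiv_cat; [exact: coxeter_equiv_refl|
    exact: coxeter_equiv_sym].
by have := coxeter_equiv_catV (rev u); rewrite revK.
Qed.

Definition coxeter_one : coxeter_group := \pi_coxeter_group [::].
Definition coxeter_mul (x y : coxeter_group) : coxeter_group :=
  \pi_coxeter_group (repr x ++ repr y).
Definition coxeter_inv (x : coxeter_group) : coxeter_group :=
  \pi_coxeter_group (rev (repr x)).

Lemma repr_coxeter (u : seq I) :
  coxeter_equiv (repr (\pi_coxeter_group u)) u.
Proof. by apply/coxeter_group_eqP; rewrite reprK. Qed.

Lemma coxeter_mul_pi u v :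
  coxeter_mul (\pi_coxeter_group u) (\pi_coxeter_group v) =
  \pi_coxeter_group (u ++ v).
Proof.
by apply/coxeter_group_eqP; apply: coxeter_equiv_cat; exact: repr_coxeter.
Qed.

Lemma coxeter_inv_pi u :
  coxeter_inv (\pi_coxeter_group u) = \pi_coxeter_group (rev u).
Proof.
by apply/coxeter_group_eqP; apply: coxeter_equiv_rev; exact: repr_coxeter.
Qed.

Lemma coxeter_mulA : associative coxeter_mul.
Proof.
move=> x y z; apply/coxeter_group_eqP.
apply: (@coxeter_equiv_trans _ (repr x ++ (repr y ++ repr z))).
  by apply: coxeter_equiv_cat; [exact: coxeter_equiv_refl|exact: repr_coxeter].
rewrite catA; apply: coxeter_equiv_cat; last exact: coxeter_equiv_refl.
exact/coxeter_equiv_sym/repr_coxeter.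
Qed.

Lemma coxeter_mul1 : left_id coxeter_one coxeter_mul.
Proof. by move=> x; rewrite -[x]reprK coxeter_mul_pi. Qed.

Lemma coxeter_mulr1 : right_id coxeter_one coxeter_mul.
Proof. by move=> x; rewrite -[x]reprK coxeter_mul_pi cats0. Qed.

Lemma coxeter_mulV : left_inverse coxeter_one coxeter_inv coxeter_mul.
Proof.
move=> x; rewrite -[x]reprK coxeter_inv_pi coxeter_mul_pi.
apply/coxeter_group_eqP.
by have := coxeter_equiv_catV (rev (repr x)); rewrite revK.
Qed.

Lemma coxeter_mulrV : right_inverse coxeter_one coxeter_inv coxeter_mul.
Proof.
move=> x; rewrite -[x]reprK coxeter_inv_pi coxeter_mul_pi.
exact/coxeter_group_eqP/coxeter_equiv_catV.
Qed.

HB.instance Definition _ := isGroup.Build coxeter_group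
  coxeter_mulA coxeter_mul1 coxeter_mulr1 coxeter_mulV coxeter_mulrV.

Definition coxeter_gen (i : I) : coxeter_group := \pi_coxeter_group [:: i].

Lemma coxeter_piE (u : seq I) :
  \pi_coxeter_group u = \prod_(i <- u) coxeter_gen i.
Proof.
elim: u => [|i u ih]; first by rewrite big_nil.
by rewrite big_cons -ih; symmetry; exact: (coxeter_mul_pi [:: i] u).
Qed.

Lemma coxeter_gen_rel i j :
  (coxeter_gen i * coxeter_gen j) ^+ m i j = 1.
Proof.
have prodE k : \prod_(l <- flatten (nseq k [:: i; j])) coxeter_gen l =
    (coxeter_gen i * coxeter_gen j) ^+ k.
  by elim: k => [|k ih]; rewrite /= ?big_nil // !big_cons ih expgS mulgA.
rewrite -prodE -coxeter_piE; apply/coxeter_group_eqP.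
by have := coxeter_equiv_rel [::] [::] i j; rewrite cats0.
Qed.

Lemma coxeter_group_universal (G : groupType) (f : I -> G) :
  (forall i j, (f i * f j) ^+ m i j = 1) ->
  exists! F : coxeter_group -> G,
    {morph F : x y / x * y} /\ (forall i, F (coxeter_gen i) = f i).
Proof.
move=> fR; pose h (u : seq I) := \prod_(i <- u) f i.
have h_equiv u v : coxeter_equiv u v -> h u = h v.
  elim=> {u v} [u v i j|//|u v _ -> //|u v w _ -> _ -> //].
  rewrite /h !big_cat /=; congr (_ * _); rewrite -[RHS]mul1g; congr (_ * _).
  rewrite -[RHS](fR i j); elim: (m i j) => [|k ih]; first by rewrite big_nil.
  by rewrite /= !big_cons ih expgS mulgA.
exists (fun x => h (repr x)); split=> [|F [FM FE]].
  split=> [x y|i].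
    rewrite -[LHS](h_equiv _ _ (coxeter_equiv_sym (repr_coxeter _))).
    by rewrite /h big_cat.
  by rewrite (h_equiv _ _ (repr_coxeter _)) /h big_seq1.
apply/funext => x; rewrite -[x in RHS]reprK coxeter_piE /h.
elim: (repr x) => [|i u ih]; last by rewrite !big_cons FM FE ih.
by rewrite !big_nil; apply: (mulgI (F 1)); rewrite mulg1 -FM mulg1.
Qed.

End CoxeterGroup.

Arguments coxeter_group {I} m.

Definition involution {G : groupType} (x : G) : Prop := x <> 1 /\ x ^+ 2 = 1.

Definition conj_class {G : groupType} (x : G) : set G := range (conjg x).

Definition involution_classes (G : groupType) : set (set G) :=
  [set conj_class x | x in [set x : G | involution x]].

Arguments involution_classes : clear implicits.

Local Open Scope nat_scope.

Definition path_adjacent (i j : nat) : bool := (j == i.+1) || (i == j.+1).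

(* The vertices of the path are 0, ..., n.-1. *)
Definition entryA (i j : nat) : nat :=
  if i == j then 1 else if path_adjacent i j then 3 else 2.

(* The last edge joins n.-2 and n.-1. *)
Definition entryC (n i j : nat) : nat :=
  if i == j then 1
  else if path_adjacent i j then (if maxn i j == n.-1 then 4 else 3)
  else 2.

Lemma path_adjacentC i j : path_adjacent i j = path_adjacent j i.
Proof. by rewrite /path_adjacent orbC. Qed.

Lemma matrixA_sym n (i j : 'I_n) : entryA i j = entryA j i.
Proof. by rewrite /entryA eq_sym path_adjacentC. Qed.

Lemma matrixA_eq1 n (i j : 'I_n) : entryA i j = 1%N <-> i = j.
Proof.
split=> [|->]; last by rewrite /entryA eqxx.
by rewrite /entryA; case: eqP => [/val_inj //|_]; case: ifP.
Qed.

Lemma matrixC_sym n (i j : 'I_n) : entryC n i j = entryC n j i.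
Proof. by rewrite /entryC eq_sym path_adjacentC maxnC. Qed.

Lemma matrixC_eq1 n (i j : 'I_n) : entryC n i j = 1%N <-> i = j.
Proof.
split=> [|->]; last by rewrite /entryC eqxx.
by rewrite /entryC; case: eqP => [/val_inj //|_]; do 2?case: ifP.
Qed.

Definition diagramA (n : nat) : coxeter_matrix 'I_n :=
  CoxeterMatrix (@matrixA_sym n) (@matrixA_eq1 n).

Definition diagramC (n : nat) : coxeter_matrix 'I_n :=
  CoxeterMatrix (@matrixC_sym n) (@matrixC_eq1 n).

(* Main.v *)
(* The group W of type C_n acts on the signed points {+-0, ..., +-(n-1)}.  The
   parabolic subgroup on s_k, ..., s_(n-1) is the union of the cosets of the one
   on s_(k+1), ..., s_(n-1) with representatives carrying the point k to the
   various signed points, so an element fixing k lies in the smaller parabolic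
   and the action is faithful.  Hence an involution can be conjugated, one point
   or one pair of points at a time, to a product of b adjacent transpositions
   followed by a sign changes, with 2 b + a <= n, and (b, a) is recovered by
   counting the points that are moved and those that are negated.  Type A_n
   follows from type C_(n+1), of which it is a retract. *)
Require Import Defs.
From mathcomp Require Import all_boot all_fingroup.
From mathcomp Require Import generic_quotient boolp classical_sets cardinality.
From mathcomp Require Import zify.

Set Implicit Arguments.
Unset Strict Implicit.
Unset Printing Implicit Defensive.

(** * The hyperoctahedral group from its presentation *)

Section Hyperoctahedral.
Local Open Scope group_scope.

Context {G : groupType} (n : nat) (s : nat -> G).

(** Words grow on the right, matching the action below, which composes from left to right. Closure
    under inverses comes from the generators being involutions. *)
Inductive parabolic (k : nat) : G -> Prop :=
| parabolic1 : parabolic k 1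
| parabolic_mulr x i : parabolic k x -> (k <= i)%N -> parabolic k (x * s i).

Hypothesis s_sq : forall i, s i * s i = 1.
Hypothesis s_commute : forall i j, (i.+1 < j)%N -> commute (s i) (s j).
Hypothesis s_braid : forall i, (i.+2 < n)%N ->
  s i * s i.+1 * s i = s i.+1 * s i * s i.+1.
Hypothesis s_quad : forall i, i.+2 = n ->
  s i * s i.+1 * s i * s i.+1 = s i.+1 * s i * s i.+1 * s i.
Hypothesis s_out : forall i, (n <= i)%N -> s i = 1.

Lemma sV i : (s i)^-1 = s i.
Proof. exact: mulg1_eq. Qed.

Lemma sK i x : x * s i * s i = x.
Proof. by rewrite -mulgA s_sq mulg1. Qed.

Lemma parabolic_gen k i : (k <= i)%N -> parabolic k (s i).
Proof. by move=> ki; rewrite -[s i]mul1g; apply: parabolic_mulr ki; left. Qed.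

Lemma parabolicM k x y : parabolic k x -> parabolic k y -> parabolic k (x * y).
Proof.
move=> kx; elim=> [|z i _ ih ki]; first by rewrite mulg1.
by rewrite mulgA; apply: parabolic_mulr.
Qed.

Lemma parabolicV k x : parabolic k x -> parabolic k x^-1.
Proof.
elim=> [|z i _ ih ki]; first by rewrite invg1; left.
by rewrite invgM sV; apply: parabolicM (parabolic_gen _) ih.
Qed.

Lemma parabolicW k l x : (k <= l)%N -> parabolic l x -> parabolic k x.
Proof.
move=> kl; elim=> [|z i _ ih li]; first by left.
by apply: parabolic_mulr ih (leq_trans kl li).
Qed.

Lemma parabolic_commute k x y :
  (forall i, (k <= i)%N -> commute y (s i)) -> parabolic k x -> commute y x.
Proof.
move=> ky; elim=> [|z i _ ih ki]; first exact: commute1.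
exact: commuteM ih (ky _ ki).
Qed.

(** It carries the point i to j. For fixed i, the climbs followed by an optional sign change of j
    represent the cosets of [parabolic i.+1] in [parabolic i]. *)
Definition climb (i j : nat) : G := \prod_(i <= l < j) s l.

Lemma parabolic_climb i j : parabolic i (climb i j).
Proof.
rewrite /climb big_nat; apply: big_ind => [||l /andP[il _]].
- by left.
- exact: parabolicM.
- exact: parabolic_gen.
Qed.

Lemma climb_commute i j k : (j < i)%N -> commute (s i) (climb k j).
Proof.
move=> ji; rewrite /climb big_nat; apply: commute_prod => l /andP[_ lj].
by apply/commute_sym/s_commute; lia.
Qed.

(** Once [s i] has moved left past the factors beyond [s i.+1], one braid relation turns it into
    [s i.+1], which commutes with the factors below [s i]. *)
Lemma climb_braid k i j : (k <= i)%N -> (i.+1 < j)%N -> (j < n)%N ->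
  climb k j * s i = s i.+1 * climb k j.
Proof.
move=> ki ij jn.
have -> : climb k j = climb k i * s i * s i.+1 * climb i.+2 j.
  rewrite /climb (big_cat_nat _ (n := i)) //=; last by lia.
  by rewrite [X in _ * X]big_ltn ?[X in _ * (_ * X)]big_ltn ?mulgA; try lia.
have c1 : commute (s i) (climb i.+2 j).
  by apply: parabolic_commute (parabolic_climb _ _) => l; exact: s_commute.
have c2 : commute (s i.+1) (climb k i) by exact: climb_commute.
rewrite -[LHS]mulgA -c1 !mulgA c2 -!mulgA; congr (_ * _).
by rewrite !mulgA s_braid //; lia.
Qed.

(* Under the action below, [sgn j] is the change of sign of the point j.  It is
   locked because [rewrite mulgA] would otherwise unfold it to a product. *)
Definition sgn (j : nat) : G :=
  locked (climb j n.-1 * s n.-1 * (climb j n.-1)^-1).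

Lemma sgnE j : (j.+1 < n)%N -> sgn j = s j * sgn j.+1 * s j.
Proof.
move=> jn; rewrite /sgn -!lock {1 2}/climb big_ltn; last by lia.
by rewrite invgM sV !mulgA.
Qed.

Lemma sgn_last : sgn n.-1 = s n.-1.
Proof. by rewrite /sgn -lock /climb big_geq // invg1 mulg1 mul1g. Qed.

Lemma sgn_sq j : sgn j * sgn j = 1.
Proof. by rewrite /sgn -lock !mulgA mulgVK sK mulgV. Qed.

Lemma parabolic_sgn j : (j < n)%N -> parabolic j (sgn j).
Proof.
move=> jn; have cj := parabolic_climb j n.-1; rewrite /sgn -lock.
apply: parabolicM (parabolicV cj); apply: parabolic_mulr cj _; lia.
Qed.

Lemma sgn_commute_low i j : (i.+1 < j)%N -> (j < n)%N -> commute (s i) (sgn j).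
Proof.
move=> ij jn; apply: parabolic_commute (parabolic_sgn jn) => l jl.
by apply: s_commute; lia.
Qed.

(** Descending induction on j through [sgnE]. Only the neighbour i = j + 1 needs more than commuting
    generators: the relation of order 4 at the end of the diagram, the braid relation elsewhere. *)
Lemma sgn_commute_high i j : (j < i)%N -> commute (s i) (sgn j).
Proof.
have [in_|ni] := ltnP i n; last first.
  by move=> _; rewrite s_out //; apply/commute_sym/commute1.
move: {2}(n - j) (leqnn (n - j)) => d; elim: d j => [|d ih] j jd ji; first lia.
have [j1i|] := ltnP j.+1 i.
  rewrite sgnE; last by lia.
  have c : commute (s i) (s j) by apply/commute_sym/s_commute.
  by apply: commuteM (commuteM c _) c; apply: ih; lia.
move=> ij; have {ji ij} ei : i = j.+1 by lia.
subst i; rewrite sgnE //.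
have [j2n|nj2] := ltnP j.+2 n; last first.
  have ej : j.+2 = n by lia.
  have -> : j.+1 = n.-1 by lia.
  rewrite sgn_last; have -> : n.-1 = j.+1 by lia.
  by rewrite /commute !mulgA -s_quad.
have c : commute (s j) (sgn j.+2) by exact: sgn_commute_low.
(* Entering [s j * s j.+1 * sgn j.+2 * s j.+1 * s j] from the left, [s j.+1] becomes [s j], passes
   [sgn j.+2] and leaves as [s j.+1]. *)
rewrite sgnE // /commute !mulgA -s_braid // -(mulgA _ (s j) (sgn _)) c.
by rewrite -!mulgA; do 3!congr (_ * _); rewrite !mulgA s_braid.
Qed.

(* The pair (p, b) stands for the signed point p, negative when b is true. *)
Definition act_gen (i : nat) (p : nat * bool) : nat * bool :=
  if (i.+1 < n)%N then
    (if p.1 == i then i.+1 else if p.1 == i.+1 then i else p.1, p.2)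
  else (p.1, p.2 (+) ((i.+1 == n) && (p.1 == i))).

(** * Coset decomposition of the parabolic subgroups *)

Lemma sgn_mulr i j b : (i.+1 < n)%N -> (j < n)%N ->
  sgn j * s i = s i * sgn (act_gen i (j, b)).1.
Proof.
move=> i1n jn; rewrite /act_gen i1n /=; case: eqP => [->|ji].
  by rewrite sgnE // sK.
case: eqP => [->|ji1]; first by rewrite (@sgnE i) // !mulgA s_sq mul1g.
apply/commute_sym; have [ij|ij] := ltnP i j.
  by apply: sgn_commute_low => //; lia.
by apply: sgn_commute_high; lia.
Qed.

(** When i is j or j - 1, the generator lengthens or shortens the climb. Otherwise it comes out on
    the left, as [s i.+1] or unchanged, with an index above k. *)
Lemma climb_mulr k i j b : (k <= i)%N -> (i.+1 < n)%N -> (k <= j < n)%N ->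
  exists2 h, parabolic k.+1 h &
    climb k j * s i = h * climb k (act_gen i (j, b)).1.
Proof.
move=> ki i1n /andP[kj jn]; rewrite /act_gen i1n /=; case: eqP => [->|ji].
  by exists 1; [left|rewrite mul1g /climb big_nat_recr].
case: eqP => [->|ji1].
  by exists 1; [left|rewrite mul1g /climb big_nat_recr // sK].
have [ij|ij] := ltnP i j.
  exists (s i.+1); first by apply: parabolic_gen; lia.
  by apply: climb_braid => //; lia.
exists (s i); first by apply: parabolic_gen; lia.
by apply/commute_sym/climb_commute; lia.
Qed.

(** The products of this form include 1 and are closed under right multiplication by the generators
    of index at least k. *)
Lemma parabolic_coset k x : (k < n)%N -> parabolic k x ->
  exists h j (e : bool), [/\ parabolic k.+1 h, (k <= j < n)%N &
    x = h * climb k j * sgn j ^+ e].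
Proof.
move=> kn; elim=> [|_ i _ [h [j [e [kh kjn ->]]]] ki].
  exists 1, k, false; split; [by left|lia|].
  by rewrite mul1g expg0 mulg1 /climb big_geq.
have jn : (j < n)%N by lia.
have [i1n|ni1] := ltnP i.+1 n.
  have [h' kh' climbE] := @climb_mulr k i j false ki i1n kjn.
  exists (h * h'), (act_gen i (j, false)).1, e; split.
  - exact: parabolicM.
  - by rewrite /act_gen i1n /=; case: eqP => [|_]; [|case: eqP]; lia.
  - rewrite -(mulgA h h') -climbE !expgb; case: e.
      by rewrite -mulgA (@sgn_mulr i j false) // !mulgA.
    by rewrite !mulg1 mulgA.
have [ni|] := leqP n i; first by exists h, j, e; rewrite (s_out ni) mulg1.
move=> in_; have ei : i = n.-1 by lia.
(* The last generator is [sgn n.-1]: it toggles e if j = n - 1, and otherwise commutes with the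
   representative and joins h. *)
have [ej|ej] := eqVneq j n.-1.
  exists h, j, (~~ e); split => //; rewrite ei -sgn_last ej !expgb.
  by case: e; rewrite ?mulg1 // -mulgA sgn_sq mulg1.
exists (h * s i), j, e; split=> //.
  by apply: parabolic_mulr => //; lia.
have c : commute (s i) (climb k j * sgn j ^+ e).
  by apply: commuteM; [apply: climb_commute|apply/commuteX/sgn_commute_high]; lia.
by rewrite -!mulgA c !mulgA.
Qed.

(** * The action on signed points and its faithfulness *)

Hypothesis s_generate : forall x, parabolic 0 x.
Variable act : G -> nat * bool -> nat * bool.
Hypothesis actM : forall x y p, act (x * y) p = act y (act x p).
Hypothesis act_s : forall i p, act (s i) p = act_gen i p.

Lemma act_genK i : involutive (act_gen i).
Proof.
move=> [p b]; rewrite /act_gen; case i1n: (i.+1 < n)%N => /=; last first.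
  by rewrite -addbA addbb addbF.
by congr pair; repeat case: eqP; lia.
Qed.

Lemma act1 p : act 1 p = p.
Proof. by rewrite -(s_sq 0) actM !act_s act_genK. Qed.

Lemma actK x : cancel (act x) (act x^-1).
Proof. by move=> p; rewrite -actM mulgV act1. Qed.

Lemma act_sign x p b :
  act x (p, b) = ((act x (p, false)).1, b (+) (act x (p, false)).2).
Proof.
elim: (s_generate x) => [|y i _ ih _]; first by rewrite !act1 addbF.
rewrite !actM !act_s ih; case: (act y (p, false)) => q c.
by rewrite /act_gen; case: ifP => _ //=; rewrite addbA.
Qed.

Lemma parabolic_bound k x p b : parabolic k x -> (k <= p < n)%N ->
  (k <= (act x (p, b)).1 < n)%N.
Proof.
move=> kx kpn; elim: kx => [|y i _ ih ki]; first by rewrite act1.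
rewrite actM act_s; move: (act y _) ih => [q c] /=.
by rewrite /act_gen; case: ifP => i1n //=; repeat case: eqP; lia.
Qed.

Lemma parabolic_fix k x p b : parabolic k x -> (p < k)%N -> act x (p, b) = (p, b).
Proof.
move=> kx pk; elim: kx => [|y i _ ih ki]; first by rewrite act1.
rewrite actM act_s ih /act_gen; case: ifP => i1n /=.
  by congr pair; repeat case: eqP; lia.
have -> : (p == i) = false by lia.
by rewrite andbF addbF.
Qed.

Lemma act_climb k j b : (k <= j < n)%N -> act (climb k j) (k, b) = (j, b).
Proof.
elim: j => [|j ih] kj.
  have -> : k = 0%N by lia.
  by rewrite /climb big_geq // act1.
have [->|kj1] := eqVneq k j.+1; first by rewrite /climb big_geq ?act1.
rewrite /climb big_nat_recr /=; last by lia.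
rewrite actM -/(climb k j) ih; last by lia.
by rewrite act_s /act_gen /= eqxx ifT //; lia.
Qed.

Lemma act_sgn j p b : (j < n)%N -> act (sgn j) (p, b) = (p, b (+) (p == j)).
Proof.
move: {2}(n - j) (leqnn (n - j)) => d; elim: d j p b => [|d ih] j p b; first lia.
move=> jd jn; have [j1n|nj] := ltnP j.+1 n; last first.
  have ej : j = n.-1 by lia.
  rewrite ej sgn_last -ej act_s /act_gen /=.
  have -> : (j.+1 < n)%N = false by lia.
  by have -> : (j.+1 == n) = true by lia.
rewrite sgnE // !actM !act_s {2}/act_gen j1n ih //; try lia.
rewrite /act_gen j1n /=.
by congr (_, _ (+) _); repeat case: eqP; lia.
Qed.

(** The data j and e of the decomposition form the image of k: h fixes k, the climb carries it to j,
    and the sign change contributes e. *)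
Lemma parabolic_coset_act k x : (k < n)%N -> parabolic k x ->
  exists2 h, parabolic k.+1 h &
    x = h * climb k (act x (k, false)).1 * sgn (act x (k, false)).1 ^+
          (act x (k, false)).2.
Proof.
move=> kn /(parabolic_coset kn)[h [j [e [kh kjn xE]]]]; exists h => //.
have -> // : act x (k, false) = (j, e).
rewrite xE !actM (parabolic_fix _ kh) // act_climb // expgb.
case: {xE} e; last by rewrite act1.
by rewrite act_sgn ?eqxx //; lia.
Qed.

Lemma parabolic_stab k x : (k < n)%N -> parabolic k x ->
  act x (k, false) = (k, false) -> parabolic k.+1 x.
Proof.
move=> kn /(parabolic_coset_act kn)[h kh xE] xk; rewrite xE xk /=.
by rewrite expg0 /climb big_geq // !mulg1.
Qed.

Lemma parabolic_faithful k x : parabolic k x ->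
  (forall j, (k <= j < n)%N -> act x (j, false) = (j, false)) -> x = 1.
Proof.
move: {2}(n - k) (leqnn (n - k)) => d; elim: d k => [|d ih] k kd kx xj.
  elim: kx => // y i _ -> ki; rewrite s_out ?mulg1 //; lia.
have [kn|nk] := ltnP k n; last by apply: (ih k) => //; lia.
apply: (ih k.+1); first lia; last by move=> j jn; apply: xj; lia.
by apply: parabolic_stab => //; apply: xj; lia.
Qed.

(** * Conjugation to normal form *)

Lemma conjg_commute (x h : G) : commute x h -> x ^ h = x.
Proof. by move=> xh; rewrite conjgE xh mulKg. Qed.

Lemma parabolicJ k x h : parabolic k x -> parabolic k h -> parabolic k (x ^ h).
Proof.
by move=> kx kh; rewrite conjgE; apply: parabolicM (parabolicV kh) (parabolicM _ _).
Qed.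

Lemma sgn_commute k x : parabolic k.+1 x -> commute (sgn k) x.
Proof.
by apply: parabolic_commute => i ki; apply/commute_sym/sgn_commute_high.
Qed.

Lemma act_transitive k j e : (k <= j < n)%N ->
  exists2 g, parabolic k g & act g (k, false) = (j, e).
Proof.
move=> kjn; exists (climb k j * sgn j ^+ e).
  apply: parabolicM (parabolic_climb _ _) _; rewrite expgb.
  case: e; last by left.
  by apply: (@parabolicW k j); [lia|apply: parabolic_sgn; lia].
rewrite actM act_climb // expgb; case: e; last by rewrite act1.
by rewrite act_sgn ?eqxx //; lia.
Qed.

Lemma actJ x g p : act (x ^ g) (act g p) = act g (act x p).
Proof. by rewrite conjgE !actM actK. Qed.

Lemma act_inv x p q : act x p = q -> act x^-1 q = p.
Proof. by move=> <-; rewrite actK. Qed.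

Definition swaps (k b : nat) : G := \prod_(0 <= i < b) s (k + i.*2).
Definition sgns (k a : nat) : G := \prod_(k <= j < k + a) sgn j.

Lemma swapsS k b : swaps k b.+1 = s k * swaps k.+2 b.
Proof.
rewrite /swaps big_nat_recl // addn0; congr (_ * _); apply: eq_bigr => i _.
by congr s; lia.
Qed.

Lemma sgnsS k a : sgns k a.+1 = sgn k * sgns k.+1 a.
Proof. by rewrite /sgns big_ltn ?addnS ?addSn //; lia. Qed.

Lemma parabolic_sgns k a : (k + a <= n)%N -> parabolic k (sgns k a).
Proof.
move=> kan; rewrite /sgns big_nat; apply: big_ind => [||j kj].
- by left.
- exact: parabolicM.
- by apply: (@parabolicW k j); [lia|apply: parabolic_sgn; lia].
Qed.

(** A point negated by x is brought to k by conjugation; then [sgn k] splits off and leaves an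
    element of [parabolic k.+1] that still keeps every point up to sign. *)
Lemma conj_sgns k x : (k <= n)%N -> parabolic k x ->
  (forall j, (k <= j < n)%N -> (act x (j, false)).1 = j) ->
  exists a h, [/\ (k + a <= n)%N, parabolic k h & x ^ h = sgns k a].
Proof.
move: {2}(n - k) (leqnn (n - k)) => d; elim: d k x => [|d ih] k x kd kn kx xj.
  exists 0%N, 1; split; [lia|by left|].
  rewrite conjg1 /sgns addn0 big_geq //; apply: (parabolic_faithful kx) => j; lia.
have [all1|/existsNP[j /not_implyP[kj xjN]]] :=
    pselect (forall j, (k <= j < n)%N -> act x (j, false) = (j, false)).
  exists 0%N, 1; split; [lia|by left|].
  by rewrite conjg1 /sgns addn0 big_geq //; apply: (parabolic_faithful kx).
have {xjN} xjT : act x (j, false) = (j, true).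
  by move: (xj j kj) xjN; case: (act x _) => q [] /= ->.
have [g kg gk] := act_transitive false kj.
have gj := act_inv gk.
pose y := x ^ g^-1.
have ky : parabolic k y by apply: parabolicJ => //; exact: parabolicV.
have yk : act y (k, false) = (k, true).
  by rewrite -{1}gj actJ xjT act_sign gj.
have k_n : (k < n)%N by lia.
have [z kz] := parabolic_coset_act k_n ky.
(* Since k goes to its own negative, the climb is empty and the sign change is [sgn k]. *)
rewrite yk /= expg1 /climb big_geq // mulg1 => yE.
have zE : z = y * sgn k by rewrite yE -mulgA sgn_sq mulg1.
have zj i : (k.+1 <= i < n)%N -> (act z (i, false)).1 = i.
  move=> ki; rewrite zE actM.
  have yi : (act y (i, false)).1 = i.
    have := @parabolic_bound k g i false kg.
    case gi : (act g (i, false)) => [i' c] /= i'n.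
    have xi' : act x (i', c) = (i', c (+) (act x (i', false)).2).
      by rewrite act_sign xj //; apply: i'n; lia.
    rewrite -{1}(act_inv gi) actJ xi' act_sign /=.
    by have := act_inv gi; rewrite act_sign => -[].
  by case: (act y _) yi => _ c /= ->; rewrite act_sgn.
have [||a [h [kan kh zh]]] := ih k.+1 z _ _ kz zj; [lia|lia|].
exists a.+1, (g^-1 * h); split; first by lia.
  by apply: parabolicM (parabolicV kg) (parabolicW _ kh).
(* As h lies in [parabolic k.+1], it commutes with [sgn k] and conjugates only z. *)
rewrite conjgM -/y yE conjMg zh (conjg_commute (sgn_commute kh)) sgnsS.
by apply/commute_sym/sgn_commute/parabolic_sgns; lia.
Qed.

(** While x displaces some point, two conjugations make it exchange k and k + 1; then [s k] splits
    off, and the rest lies in [parabolic k.+2] and squares to 1. Once no point is displaced,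
    [conj_sgns] applies. *)
Lemma conj_normal k x : (k <= n)%N -> parabolic k x -> x * x = 1 ->
  exists b a h, [/\ (k + b.*2 + a <= n)%N, parabolic k h &
    x ^ h = swaps k b * sgns (k + b.*2) a].
Proof.
move: {2}(n - k) (leqnn (n - k)) => d; elim: d k x => [|d ih] k x kd kn kx xx.
  have [|a [h [kan kh xh]]] := conj_sgns kn kx; first by lia.
  by exists 0%N, a, h; rewrite addn0 /swaps big_geq // mul1g.
have [all1|/existsNP[j /not_implyP[kj xjN]]] :=
    pselect (forall j, (k <= j < n)%N -> (act x (j, false)).1 = j).
  have [a [h [kan kh xh]]] := conj_sgns kn kx all1.
  by exists 0%N, a, h; rewrite addn0 /swaps big_geq // mul1g.
have [g kg gk] := act_transitive false kj.
have gj := act_inv gk.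
pose y := x ^ g^-1.
have ky : parabolic k y by apply: parabolicJ => //; exact: parabolicV.
case yk : (act y (k, false)) => [i e].
(* If y kept k up to sign, x would keep j up to sign. *)
have kin : (k < i < n)%N.
  have kkn : (k <= k < n)%N by lia.
  have /= := @parabolic_bound k y k false ky kkn; rewrite yk /= => kin.
  have [ik|] := eqVneq i k; last by lia.
  case: xjN; move: yk; rewrite -{1}gj actJ ik => /act_inv.
  rewrite invgK act_sign gk /= => <- //.
(* Lying in [parabolic k.+1], g2 fixes k. It also absorbs the sign e, so that w exchanges k and k +
   1 without signs. *)
have [g2 kg2 g2k] := act_transitive e kin.
pose w := y ^ g2^-1.
have kw : parabolic k w.
  by apply: parabolicJ => //; apply/parabolicV/(parabolicW _ kg2).
have wk : act w (k, false) = (k.+1, false).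
  rewrite -(parabolic_fix false (parabolicV kg2) (ltnSn k)) actJ yk.
  exact: act_inv.
have ww : w * w = 1 by rewrite /w /y -!conjMg xx !conj1g.
have wk1 : act w (k.+1, false) = (k, false) by rewrite -wk -actM ww act1.
have k1n : (k.+1 < n)%N by lia.
pose v := w * s k.
have kv : parabolic k.+2 v.
  have kv : parabolic k v by apply: parabolic_mulr.
  have k1v : parabolic k.+1 v.
    apply: (parabolic_stab _ kv); first by lia.
    rewrite actM wk act_s /act_gen k1n /= ifF; last by lia.
    by rewrite eqxx.
  apply: (parabolic_stab k1n k1v).
  by rewrite actM wk1 act_s /act_gen k1n /= eqxx.
have sv x0 : parabolic k.+2 x0 -> commute (s k) x0.
  by apply: parabolic_commute => l; exact: s_commute.
have wE : w = v * s k by rewrite sK.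
(* As v commutes with [s k], the squares of v and w agree. *)
have vv : v * v = 1.
  by rewrite -ww {2}wE -(sv _ kv) wE !mulgA sK.
have [||b [a [h [kban kh vh]]]] := ih k.+2 v _ _ kv vv; [lia|lia|].
exists b.+1, a, (g^-1 * g2^-1 * h); split; first by lia.
  apply: parabolicM (parabolicM (parabolicV kg) _) (parabolicW _ kh); last by lia.
  by apply/parabolicV/(parabolicW _ kg2).
rewrite !conjgM -/y -/w wE conjMg (conjg_commute (sv _ kh)).
rewrite -(sv _ (parabolicJ kv kh)) vh swapsS !mulgA; congr (_ * sgns _ _); lia.
Qed.

(** * Conjugacy invariants of the normal forms *)

Lemma act_swaps b p e : (b.*2 <= n)%N ->
  act (swaps 0 b) (p, e) =
    (if (p < b.*2)%N then (if odd p then p.-1 else p.+1) else p, e).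
Proof.
elim: b => [|b ih] bn; first by rewrite /swaps big_geq // act1.
rewrite /swaps big_nat_recr //= actM -/(swaps 0 b) ih; last by lia.
rewrite act_s /act_gen add0n ifT /=; last by lia.
by congr pair; repeat case: ifP; lia.
Qed.

Lemma act_sgns k a p e : (k + a <= n)%N ->
  act (sgns k a) (p, e) = (p, e (+) (k <= p < k + a)%N).
Proof.
elim: a => [|a ih] kan.
  rewrite /sgns addn0 big_geq // act1; congr pair.
  have -> : (k <= p < k)%N = false by lia.
  by rewrite addbF.
rewrite /sgns addnS big_nat_recr /=; last by lia.
rewrite actM -/(sgns k a) ih; last by lia.
rewrite act_sgn; last by lia.
congr pair; rewrite -addbA; congr addb.
by case: eqP; case: (boolP (k <= p < k + a)%N); lia.
Qed.

Definition normal_form b a : G := swaps 0 b * sgns b.*2 a.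

Lemma act_normal_form b a p e : (b.*2 + a <= n)%N ->
  act (normal_form b a) (p, e) =
    (if (p < b.*2)%N then (if odd p then p.-1 else p.+1) else p,
     e (+) (b.*2 <= p < b.*2 + a)%N).
Proof.
move=> ban; rewrite actM act_swaps ?act_sgns //; last by lia.
by congr (_, _ (+) _); repeat case: ifP; lia.
Qed.

Lemma normal_form_sq b a : (b.*2 + a <= n)%N ->
  normal_form b a * normal_form b a = 1.
Proof.
move=> ban; apply: (parabolic_faithful (s_generate _)) => j jn.
rewrite actM !act_normal_form //; congr pair; repeat case: ifP; lia.
Qed.

(** Twisting each of the two points by the sign of its image makes the images equal as signed
    points, and the action is injective there. *)
Lemma act_fst_inj g : injective (fun j => (act g (j, false)).1).
Proof.
move=> i j fij; have := act_sign g i (act g (i, false)).2.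
have := act_sign g j (act g (j, false)).2; rewrite !addbb -fij.
by move=> <- /(can_inj (actK g))[].
Qed.

(** The signs that g puts on j and on its image i under x enter additively, so they cancel when x
    keeps j up to sign. *)
Lemma actJ_fst x g j (i := (act x (j, false)).1) :
  act (x ^ g) ((act g (j, false)).1, false) =
    ((act g (i, false)).1,
     (act x (j, false)).2 (+) (act g (i, false)).2 (+) (act g (j, false)).2).
Proof.
have := actJ x g (j, false); rewrite {}/i.
case: (act x (j, false)) => i e; case: (act g (j, false)) => q c /=.
rewrite act_sign [RHS]act_sign; case: (act (x ^ g) _) => q' c' /= [-> <-].
by rewrite addbC addKb.
Qed.

(** Up to signs, g permutes the points below n and matches those satisfying [P x] with those
    satisfying [P (x ^ g)]. *)
Lemma count_act_conj (P : G -> pred nat) x g :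
  (forall j, P (x ^ g) (act g (j, false)).1 = P x j) ->
  count (P (x ^ g)) (iota 0 n) = count (P x) (iota 0 n).
Proof.
move=> Pg; pose f j := (act g (j, false)).1.
have f_inj : injective f by exact: act_fst_inj.
have f_perm : perm_eq (map f (iota 0 n)) (iota 0 n).
  have f_uniq : uniq (map f (iota 0 n)) by rewrite map_inj_uniq ?iota_uniq.
  have f_sub : {subset map f (iota 0 n) <= iota 0 n}.
    move=> _ /mapP[j jn ->]; move: jn; rewrite !mem_iota => jn.
    by have := @parabolic_bound 0 g j false (s_generate g); apply.
  have [|_ f_mem] := uniq_min_size f_uniq f_sub; first by rewrite size_map.
  exact: uniq_perm f_uniq (iota_uniq _ _) f_mem.
rewrite -(seq.permP f_perm) count_map; apply: eq_count => j; exact: Pg.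
Qed.

(** On the diagonal of the signed permutation matrix of x, [displaced] counts the zeros and
    [negated] the entries -1. *)
Definition displaced x := count (fun j => (act x (j, false)).1 != j) (iota 0 n).
Definition negated x :=
  count (fun j => act x (j, false) == (j, true)) (iota 0 n).

Lemma displaced_conj x g : displaced (x ^ g) = displaced x.
Proof.
apply: (@count_act_conj (fun x j => (act x (j, false)).1 != j)) => j.
by rewrite actJ_fst /= (inj_eq (@act_fst_inj g)).
Qed.

Lemma negated_conj x g : negated (x ^ g) = negated x.
Proof.
apply: (@count_act_conj (fun x j => act x (j, false) == (j, true))) => j.
rewrite actJ_fst xpair_eqE (inj_eq (@act_fst_inj g)).
case: (act x _) => i e /=; rewrite xpair_eqE.
by case: eqP => // ->; rewrite -addbA addbb addbF.
Qed.

Lemma count_interval l m N : (l <= m)%N -> (m <= N)%N ->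
  count (fun j => l <= j < m)%N (iota 0 N) = (m - l)%N.
Proof.
move=> lm mN.
(* Truncating the bounds at N gives a formula valid for every N, which allows induction from 0. *)
suff -> : count (fun j => l <= j < m)%N (iota 0 N) =
  (minn m N - minn l N)%N by lia.
elim: N {mN} => [|N ih]; first by rewrite !minn0.
rewrite -addn1 iotaD count_cat ih [count _ (iota _ 1)]/= add0n.
by case: (boolP (l <= N < m)%N); lia.
Qed.

Lemma displaced_normal_form b a : (b.*2 + a <= n)%N ->
  displaced (normal_form b a) = b.*2.
Proof.
move=> ban; rewrite -[RHS]subn0 -(@count_interval 0 b.*2 n) //; last by lia.
apply: eq_in_count => j _; rewrite act_normal_form //=.
repeat case: ifP; lia.
Qed.

Lemma negated_normal_form b a : (b.*2 + a <= n)%N ->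
  negated (normal_form b a) = a.
Proof.
move=> ban; rewrite -[RHS](addKn b.*2) -(@count_interval b.*2 (b.*2 + a) n) //.
  apply: eq_in_count => j _; rewrite act_normal_form // xpair_eqE.
  repeat case: ifP; lia.
by lia.
Qed.

Lemma normal_form_inj b a b' a' g : (b.*2 + a <= n)%N -> (b'.*2 + a' <= n)%N ->
  normal_form b a ^ g = normal_form b' a' -> b = b' /\ a = a'.
Proof.
move=> ban ban' e; have := displaced_conj (normal_form b a) g.
have := negated_conj (normal_form b a) g.
rewrite e !negated_normal_form // !displaced_normal_form //; lia.
Qed.
End Hyperoctahedral.

(** * Morphisms and generators *)

Section Morphisms.
Local Open Scope group_scope.
Context {G H : groupType} (F : G -> H).
Hypothesis FM : {morph F : x y / x * y}.

Lemma morph_one : F 1 = 1.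
Proof. by apply: (mulgI (F 1)); rewrite -FM !mulg1. Qed.

Lemma morph_inv x : F x^-1 = (F x)^-1.
Proof. by symmetry; apply: mulg1_eq; rewrite -FM mulgV morph_one. Qed.

Lemma morph_conj x y : F (x ^ y) = F x ^ F y.
Proof. by rewrite !conjgE !FM morph_inv. Qed.
End Morphisms.

Section Generators.
Local Open Scope group_scope.
Context {n : nat} (m : coxeter_matrix 'I_n).

Lemma coxeter_ind (P : coxeter_group m -> Prop) :
  P 1 -> (forall i x, P x -> P (coxeter_gen m i * x)) -> forall x, P x.
Proof.
move=> P1 PM x; rewrite -[x]reprK coxeter_piE.
by apply: big_rec => // i y _; exact: PM.
Qed.

(* The value 1 outside the diagram makes indices range over [nat]. *)
Definition nat_gen (i : nat) : coxeter_group m :=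
  if insub i is Some j then coxeter_gen m j else 1.

Lemma nat_gen_ord (i : 'I_n) : nat_gen i = coxeter_gen m i.
Proof. by rewrite /nat_gen valK. Qed.

Lemma nat_gen_out i : (n <= i)%N -> nat_gen i = 1.
Proof. by move=> ni; rewrite /nat_gen insubN // -leqNgt. Qed.

Lemma nat_gen_sq i : nat_gen i * nat_gen i = 1.
Proof.
rewrite /nat_gen; case: insubP => [j _ _|_]; last by rewrite mulg1.
by have := coxeter_gen_rel m j j; rewrite (coxeter_entry_eq1 m j j).2.
Qed.

Lemma parabolic_nat_gen x : parabolic nat_gen 0 x.
Proof.
elim/coxeter_ind: x => [|i x ih]; first by left.
by rewrite -nat_gen_ord; apply: parabolicM ih; exact: parabolic_gen.
Qed.
End Generators.

(** * Coxeter relations of two involutions in braid form *)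

Section InvolutivePairs.
Local Open Scope group_scope.
Context {G : groupType} (a b : G).
Hypotheses (aa : a * a = 1) (bb : b * b = 1).

Lemma involutions_commute : (a * b) ^+ 2 = 1 -> commute a b.
Proof.
rewrite expg2 => /mulg1_eq; rewrite invgM (mulg1_eq aa) (mulg1_eq bb).
exact: esym.
Qed.

Lemma involutions_braid : (a * b) ^+ 3 = 1 -> a * b * a = b * a * b.
Proof.
rewrite !expgS mulg1 => e.
have {e} : a * b * a * (b * a * b) = 1 by rewrite -[RHS]e !mulgA.
by move=> /mulg1_eq <-; rewrite !invgM (mulg1_eq aa) (mulg1_eq bb) mulgA.
Qed.

Lemma involutions_quad : (a * b) ^+ 4 = 1 -> a * b * a * b = b * a * b * a.
Proof.
rewrite !expgS mulg1 => e.
have {e} : a * b * a * b * (a * b * a * b) = 1 by rewrite -[RHS]e !mulgA.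
by move=> /mulg1_eq <-; rewrite !invgM (mulg1_eq aa) (mulg1_eq bb) !mulgA.
Qed.
End InvolutivePairs.

(** * Relations of type C on the signed points *)

Section ActGen.
Context (n : nat).

Lemma act_gen_up i b : i.+1 < n -> act_gen n i (i, b) = (i.+1, b).
Proof. by move=> i1n; rewrite /act_gen i1n /= eqxx. Qed.

Lemma act_gen_down i b : i.+1 < n -> act_gen n i (i.+1, b) = (i, b).
Proof. by move=> i1n; rewrite /act_gen i1n /= eqxx ifF //; lia. Qed.

Lemma act_gen_neg i b : i.+1 = n -> act_gen n i (i, b) = (i, ~~ b).
Proof.
move=> i1n; rewrite /act_gen ifF /=; last by lia.
by rewrite i1n !eqxx addbT.
Qed.

Lemma act_gen_fix i p b : p != i -> (p != i.+1) || (i.+1 == n) ->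
  act_gen n i (p, b) = (p, b).
Proof.
move=> pi pi1; rewrite /act_gen (negbTE pi) andbF addbF.
by case: ltnP => //= i1n; rewrite ifF //; lia.
Qed.

(** Evaluates one generator at one point; [lia] selects the rule from the known position of the
    point. *)
Ltac act_gen_step :=
  match goal with |- context [act_gen n ?i (?p, ?b)] =>
    first [ rewrite (@act_gen_up i b); [|lia]
          | rewrite (@act_gen_down i b); [|lia]
          | rewrite (@act_gen_neg i b); [|lia]
          | rewrite (@act_gen_fix i p b); [|lia|lia] ] end.

(** Adjacent generators compose to a 3-cycle of three consecutive points or, at the end of the
    diagram, to a 4-cycle of the last two points with signs. Distinct non-adjacent ones affect
    disjoint sets of points. *)
Lemma act_gen_rel i j p : i < n -> j < n ->
  iter (entryC n i j) (fun q => act_gen n j (act_gen n i q)) p = p.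
Proof.
move=> in_ jn; case: p => p b; rewrite /entryC.
case: eqP => [->|ij]; first by rewrite /= act_genK.
have {ij} [ej|[ei|ij]] : j = i.+1 \/ (i = j.+1 \/ (i.+1 < j \/ j.+1 < i)) by lia.
- subst j; rewrite /path_adjacent eqxx /=; case: eqP => ni /=;
  have [->|pi] := eqVneq p i; try have [->|pi1] := eqVneq p i.+1;
  try have [->|pi2] := eqVneq p i.+2;
  by repeat act_gen_step; rewrite ?negbK.
- subst i; rewrite /path_adjacent eqxx orbT /=; case: eqP => ni /=;
  have [->|pj] := eqVneq p j; try have [->|pj1] := eqVneq p j.+1;
  try have [->|pj2] := eqVneq p j.+2;
  by repeat act_gen_step; rewrite ?negbK.
have -> : path_adjacent i j = false by rewrite /path_adjacent; lia.
have [i1n|i1n] : i.+1 < n \/ i.+1 = n by lia.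
all: have [j1n|j1n] : j.+1 < n \/ j.+1 = n by lia.
all: rewrite /=; have [->|pi] := eqVneq p i; try have [->|pj] := eqVneq p j;
  try have [->|pi1] := eqVneq p i.+1; try have [->|pj1] := eqVneq p j.+1.
all: by repeat act_gen_step; rewrite ?negbK.
Qed.
End ActGen.

(** * Type C *)

Section TypeC.
Local Open Scope group_scope.
Context (n : nat).
Notation W := (coxeter_group (diagramC n)).
Notation s := (nat_gen (diagramC n)).

Lemma genC_rel i j : (i < n)%N -> (j < n)%N -> (s i * s j) ^+ entryC n i j = 1.
Proof.
move=> in_ jn; have := coxeter_gen_rel (diagramC n) (Ordinal in_) (Ordinal jn).
by rewrite -!nat_gen_ord.
Qed.

Lemma genC_commute i j : (i.+1 < j)%N -> commute (s i) (s j).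
Proof.
move=> ij; have [jn|nj] := ltnP j n; last first.
  by rewrite (nat_gen_out _ nj); exact: commute1.
apply: involutions_commute; [exact: nat_gen_sq|exact: nat_gen_sq|].
have i_n : (i < n)%N by lia.
rewrite -[RHS](genC_rel i_n jn) /entryC ifF; last by lia.
by rewrite ifF // /path_adjacent; lia.
Qed.

Lemma genC_braid i : (i.+2 < n)%N -> s i * s i.+1 * s i = s i.+1 * s i * s i.+1.
Proof.
move=> i2n; apply: involutions_braid; [exact: nat_gen_sq|exact: nat_gen_sq|].
have i_n : (i < n)%N by lia.
have i1n : (i.+1 < n)%N by lia.
rewrite -[RHS](genC_rel i_n i1n) /entryC ifF; last by lia.
by rewrite /path_adjacent eqxx ifF //; lia.
Qed.

Lemma genC_quad i : i.+2 = n ->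
  s i * s i.+1 * s i * s i.+1 = s i.+1 * s i * s i.+1 * s i.
Proof.
move=> i2n; apply: involutions_quad; [exact: nat_gen_sq|exact: nat_gen_sq|].
have i_n : (i < n)%N by lia.
have i1n : (i.+1 < n)%N by lia.
rewrite -[RHS](genC_rel i_n i1n) /entryC ifF; last by lia.
by rewrite /path_adjacent eqxx ifT //; lia.
Qed.

Definition act_word (u : seq 'I_n) (p : nat * bool) : nat * bool :=
  foldl (fun q (i : 'I_n) => act_gen n i q) p u.

Lemma act_word_equiv u v :
  coxeter_equiv (diagramC n) u v -> act_word u =1 act_word v.
Proof.
elim=> {u v} [u v i j|//|u v _ uv|u v w _ uv _ vw] p; last 2 first.
- by rewrite uv.
- by rewrite uv vw.
rewrite /act_word !foldl_cat; congr (foldl _ _ v); move: (foldl _ p u) => q.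
rewrite -[RHS](act_gen_rel q (ltn_ord i) (ltn_ord j)) /=.
elim: (entryC n i j) q => [|d ih] q //=.
by rewrite ih -iterSr.
Qed.

Definition actC (x : W) : nat * bool -> nat * bool := act_word (repr x).

Lemma actCM x y p : actC (x * y) p = actC y (actC x p).
Proof.
rewrite /actC (act_word_equiv (repr_coxeter _ _)).
by rewrite /act_word foldl_cat.
Qed.

Lemma actC_s i p : actC (s i) p = act_gen n i p.
Proof.
rewrite /nat_gen; case: insubP => [j _ <-|].
  by rewrite /actC (act_word_equiv (repr_coxeter _ _)).
rewrite -leqNgt => ni; rewrite /actC (act_word_equiv (repr_coxeter _ _)) /=.
case: p => p b; rewrite /act_gen ifF; last by lia.
have -> : (i.+1 == n) = false by lia.
by rewrite addbF.
Qed.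

Definition nfC (b a : nat) : W := normal_form n s b a.

Lemma nfC_conj (x : W) : x * x = 1 ->
  exists b a h, (b.*2 + a <= n)%N /\ x ^ h = nfC b a.
Proof.
move=> xx; have [b [a [h [ban _ xh]]]] := conj_normal (nat_gen_sq _) genC_commute
  genC_braid genC_quad (nat_gen_out _) (@parabolic_nat_gen _ _) actCM actC_s
  (leq0n n) (parabolic_nat_gen x) xx.
by exists b, a, h.
Qed.

Lemma nfC_sq b a : (b.*2 + a <= n)%N -> nfC b a * nfC b a = 1.
Proof.
exact: (normal_form_sq (nat_gen_sq _) genC_commute
  genC_braid genC_quad (nat_gen_out _) (@parabolic_nat_gen _ _) actCM actC_s).
Qed.

Lemma nfC_inj b a b' a' g : (b.*2 + a <= n)%N -> (b'.*2 + a' <= n)%N ->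
  nfC b a ^ g = nfC b' a' -> b = b' /\ a = a'.
Proof.
exact: (normal_form_inj (nat_gen_sq _) (@parabolic_nat_gen _ _) actCM actC_s).
Qed.

Lemma nfC00 : nfC 0 0 = 1.
Proof. by rewrite /nfC /normal_form /swaps /sgns !big_geq // mulg1. Qed.
End TypeC.

(** * Counting classes by a transversal *)

Section Classes.
Local Open Scope group_scope.
Local Open Scope classical_set_scope.
Context {G : groupType}.

Lemma conj_classP (x y : G) : conj_class x = conj_class y <-> exists g, x ^ g = y.
Proof.
split=> [xy|[g <-]].
  have : conj_class y y by exists 1; rewrite ?conjg1.
  by rewrite -xy => -[g _ <-]; exists g.
apply/seteqP; split=> _ [h _ <-]; last by exists (g * h); rewrite ?conjgM.
by exists (g^-1 * h); rewrite // conjgM conjgK.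
Qed.

(** The values of f on A meet every class of involutions exactly once, so the classes are an
    injective image of A. *)
Lemma involution_classes_card (T : Type) (A : set T) (f : T -> G) :
  (forall t, A t -> involution (f t)) ->
  (forall x : G, involution x -> exists t g, A t /\ x ^ g = f t) ->
  (forall t t' g, A t -> A t' -> f t ^ g = f t' -> t = t') ->
  (involution_classes G #= A)%card.
Proof.
move=> fA fS fI.
have -> : involution_classes G = (fun t => conj_class (f t)) @` A.
  apply/seteqP; split=> [_ [x xI <-]|_ [t At <-]]; last first.
    by exists (f t) => //; exact: fA.
  have [t [g [At xg]]] := fS x xI.
  by exists t => //; symmetry; apply/conj_classP; exists g.
apply: inj_card_eq => t t' /set_mem At /set_mem At' /conj_classP[g].
exact: fI.
Qed.

Lemma card_seq (T : eqType) (r : seq T) : uniq r ->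
  ([set x | x \in r] #= `I_(size r))%card.
Proof.
move=> r_uniq; rewrite card_eq_sym.
have -> : `I_(size r) = (index^~ r) @` [set x | x \in r].
  apply/seteqP; split=> [i /= ir|_ [x xr <-]] /=; last by rewrite index_mem.
  case: r r_uniq ir => // x r r_uniq ir.
  by exists (nth x (x :: r) i); [exact: mem_nth|exact: index_uniq].
by apply: inj_card_eq => x y /set_mem xr /set_mem yr; exact: index_inj.
Qed.
End Classes.

(** * The count in type C *)

Section CountC.
Context (n : nat).

(** The shape (b, a) stands for b swaps and a sign changes; (0, 0), the shape of the identity, is
    included. *)
Definition shapesC : seq (nat * nat) :=
  [seq (b, a) | b <- iota 0 n./2.+1, a <- iota 0 (n - b.*2).+1].

Lemma mem_shapesC b a : ((b, a) \in shapesC) = (b.*2 + a <= n).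
Proof.
apply/allpairsPdep/idP => [[b' [a' [+ + [-> ->]]]]|ban].
  by rewrite !mem_iota; lia.
by exists b, a; rewrite !mem_iota; split=> //; lia.
Qed.

Lemma uniq_shapesC : uniq shapesC.
Proof.
apply: allpairs_uniq_dep => [|b _|]; rewrite ?iota_uniq //.
by move=> [b a] [b' a'] _ _ /= [-> ->].
Qed.

Lemma size_shapesC :
  size shapesC = sumn [seq (n - b.*2).+1 | b <- iota 0 n./2.+1].
Proof.
by rewrite size_allpairs_dep; congr sumn; apply: eq_map => b; rewrite size_iota.
Qed.
End CountC.

(** The sum of 2 (k - b) + 1 over b from 0 to k is (k + 1)^2. The successor sets the identity
    apart. *)
Lemma size_shapesC_even k : size (shapesC (2 * k)) = (k ^ 2 + 2 * k).+1.
Proof.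
rewrite size_shapesC mul2n doubleK; elim: k => [|k ih] //.
(* Removing b = 0 and shifting the other b by one leaves the summands for k. *)
rewrite -[iota 0 k.+2]/(0 :: iota (1 + 0) k.+1) iotaDl.
move: (iota 0 k.+1) ih => r ih; rewrite /= -map_comp.
rewrite (@eq_map _ _ _ (fun b => (k.*2 - b.*2).+1)) ?ih; last first.
  by move=> b; rewrite [LHS]/= add1n !doubleS ?subSS.
rewrite !expnS !expn0; lia.
Qed.

(** The sum of 2 (k - b) + 2 over b from 0 to k is (k + 1) (k + 2). *)
Lemma size_shapesC_odd k : size (shapesC (2 * k + 1)) = (k ^ 2 + 3 * k + 1).+1.
Proof.
rewrite size_shapesC mul2n addn1.
have -> : k.*2.+1./2 = k by lia.
elim: k => [|k ih] //.
rewrite -[iota 0 k.+2]/(0 :: iota (1 + 0) k.+1) iotaDl.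
move: (iota 0 k.+1) ih => r ih; rewrite /= -map_comp.
rewrite (@eq_map _ _ _ (fun b => (k.*2.+1 - b.*2).+1)) ?ih; last first.
  by move=> b; rewrite [LHS]/= add1n !doubleS ?subSS.
rewrite !expnS !expn0; lia.
Qed.

(** The predecessor discards the shape (0, 0), whose normal form is 1 and so no involution. *)
Lemma involution_classesC_card n :
  (involution_classes (coxeter_group (diagramC n)) #=
    `I_(size (shapesC n)).-1)%card.
Proof.
have z_in : (0, 0) \in shapesC n by rewrite mem_shapesC.
rewrite -(size_rem z_in).
apply: card_eq_trans (card_seq (rem_uniq _ (uniq_shapesC n))).
have memE b a : ((b, a) \in rem (0, 0) (shapesC n)) =
    ((b, a) != (0, 0)) && (b.*2 + a <= n).
  by rewrite (mem_rem_uniq _ (uniq_shapesC n)) inE /= mem_shapesC.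
apply: (involution_classes_card (f := fun p => nfC n p.1 p.2)).
- move=> [b a] /=; rewrite memE => /andP[ba0 ban]; split; last first.
    by rewrite expg2 nfC_sq.
  rewrite -(nfC00 n) => ba; case/eqP: ba0.
  have := @nfC_inj n b a 0 0 1%g ban (leq0n n); rewrite conjg1 ba.
  by case=> // -> ->.
- move=> x [x1 xx]; have [b [a [h [ban xh]]]] := nfC_conj xx.
  exists (b, a), h; split=> //=; rewrite memE ban andbT.
  apply/eqP => -[b0 a0]; apply: x1; apply/eqP.
  by rewrite -(conjg_eq1 x h) xh b0 a0 nfC00.
- move=> [b a] [b' a'] g /=; rewrite !memE => /andP[_ ban] /andP[_ ban'].
  by move/(nfC_inj ban ban') => [-> ->].
Qed.

(** * Type A *)

(* Killing the generator at the end of the edge labeled 4 retracts the group of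
   type C_(n+1) onto the parabolic subgroup of type A_n. *)
Section TypeA.
Local Open Scope classical_set_scope.
Local Open Scope group_scope.
Context (n : nat).
Notation WA := (coxeter_group (diagramA n)).
Notation WC := (coxeter_group (diagramC n.+1)).
Notation sA := (nat_gen (diagramA n)).
Notation sC := (nat_gen (diagramC n.+1)).

(** The edge labeled 4 ends at the vertex n, outside the first n vertices. *)
Lemma entryC_A i j : (i < n)%N -> (j < n)%N -> entryC n.+1 i j = entryA i j.
Proof.
move=> in_ jn; rewrite /entryC /entryA; case: ifP => // _; case: ifP => // _.
by rewrite ifF //; lia.
Qed.

Lemma embedding_ex : exists E : WA -> WC,
  {morph E : x y / x * y} /\ (forall i, (i < n)%N -> E (sA i) = sC i).
Proof.
have [i j|E [[EM Es] _]] :=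
    coxeter_group_universal (m := diagramA n) (f := fun i : 'I_n => sC i).
  rewrite -[coxeter_entry _ _ _]/(entryA i j) -entryC_A //.
  by apply: genC_rel; apply: ltnW; rewrite ltnS.
exists E; split=> // i in_.
have -> : sA i = coxeter_gen _ (Ordinal in_) by exact: (nat_gen_ord _ (Ordinal in_)).
exact: Es.
Qed.

(** The generator of index n goes to 1, the default value of [nat_gen]. Its relations with the other
    generators have exponent 2 or 4, and hold in the image because the generators there square to
    1. *)
Lemma retraction_ex : exists R : WC -> WA,
  {morph R : x y / x * y} /\ (forall i, R (sC i) = sA i).
Proof.
have [i j|R [[RM Rs] _]] :=
    coxeter_group_universal (m := diagramC n.+1) (f := fun i : 'I_n.+1 => sA i).
  rewrite -[coxeter_entry _ _ _]/(entryC n.+1 i j).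
  have sq k : sA k ^+ 2 = 1 by rewrite expg2 nat_gen_sq.
  have qu k : sA k ^+ 4 = 1 by rewrite (expgnA _ 2 2) sq expg1n.
  have [in_|ni] := ltnP i n; have [jn|nj] := ltnP j n.
  - rewrite entryC_A //.
    have := coxeter_gen_rel (diagramA n) (Ordinal in_) (Ordinal jn).
    by rewrite -!nat_gen_ord.
  - rewrite (nat_gen_out _ nj) mulg1 /entryC.
    have -> : (i == j :> nat) = false by lia.
    have -> : (maxn i j == n)%N by have := ltn_ord j; lia.
    by case: ifP.
  - rewrite (nat_gen_out _ ni) mul1g /entryC.
    have -> : (i == j :> nat) = false by lia.
    have -> : (maxn i j == n)%N by have := ltn_ord i; lia.
    by case: ifP.
  - by rewrite (nat_gen_out _ ni) (nat_gen_out _ nj) mulg1 expg1n.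
exists R; split=> // i; have [in_|ni] := ltnP i n.+1.
  have -> : sC i = coxeter_gen _ (Ordinal in_) by exact: (nat_gen_ord _ (Ordinal in_)).
  exact: Rs.
by rewrite !nat_gen_out ?(morph_one RM) //; lia.
Qed.

(** An embedded involution is conjugate to a normal form in type C. Retracting this conjugation
    deletes the sign changes, so the shapes (b, 0) with b positive represent all classes. The
    embedding takes a conjugacy between two of them back to type C, where b is determined. *)
Lemma involution_classesA_card :
  (involution_classes WA #= `I_n.+1./2)%card.
Proof.
have [E [EM Es]] := embedding_ex; have [R [RM Rs]] := retraction_ex.
have ER x : R (E x) = x.
  elim/(@coxeter_ind _ (diagramA n)): x => [|i x ih].
    by rewrite (morph_one EM) (morph_one RM).
  by rewrite EM RM ih -nat_gen_ord Es // Rs.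
(* Each [sgn j] is a conjugate of the last generator, which R kills. *)
have Rsgn j : R (sgn n.+1 sC j) = 1.
  rewrite /sgn -lock !RM (morph_inv RM) Rs /= (nat_gen_out _ (leqnn n)) mulg1.
  exact: mulgV.
have Rsgns k a : R (sgns n.+1 sC k a) = 1.
  rewrite /sgns; apply: (big_ind (fun x => R x = 1)) => //.
  - exact: morph_one.
  - by move=> x y; rewrite RM => -> ->; rewrite mulg1.
(* The swaps use the generators 0, 2, ..., 2 b - 2. Their indices are below n because 2 b <= n + 1,
   and E undoes R on them. *)
have ERnf b : (b.*2 <= n.+1)%N -> E (R (nfC n.+1 b 0)) = nfC n.+1 b 0.
  move=> bn; rewrite /nfC /normal_form /sgns addn0 big_geq // mulg1 /swaps big_nat.
  apply: (big_ind (fun x => E (R x) = x)) => //.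
  - by rewrite (morph_one RM) (morph_one EM).
  - by move=> x y; rewrite RM EM => -> ->.
  - by move=> i ib; rewrite Rs Es //; lia.
have card_shapes : ([set b : nat | (0 < b <= n.+1./2)%N] #= `I_n.+1./2)%card.
  rewrite card_eq_sym.
  have -> : [set b : nat | (0 < b <= n.+1./2)%N] = succn @` `I_n.+1./2.
    apply/seteqP; split=> [[|b] //= bn|_ [b /= bn <-]] //=.
    by exists b.
  by rewrite card_eq_sym; apply: inj_card_eq => x y _ _ [].
apply: card_eq_trans card_shapes.
apply: (involution_classes_card (f := fun b => R (nfC n.+1 b 0))).
- move=> b /= /andP[b0 bn]; have b2n : (b.*2 + 0 <= n.+1)%N by lia.
  split; last by rewrite expg2 -RM nfC_sq // (morph_one RM).
  move/(congr1 E); rewrite ERnf ?(morph_one EM); last by lia.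
  rewrite -(nfC00 n.+1) -[LHS]conjg1 => /nfC_inj[] //; lia.
- move=> x [x1 xx]; have [|b [a [h [ban Exh]]]] := @nfC_conj n.+1 (E x).
    by rewrite -EM -expg2 xx (morph_one EM).
  have xh : x ^ R h = R (nfC n.+1 b 0).
    rewrite -{1}[x]ER -(morph_conj RM) Exh /nfC /normal_form !RM !Rsgns //.
  exists b, (R h); split=> //=.
  have b0 : b <> 0%N.
    move=> b0; apply: x1; apply/eqP; rewrite -(conjg_eq1 x (R h)) xh b0 nfC00.
    by rewrite (morph_one RM).
  lia.
- move=> b b' g /= /andP[_ bn] /andP[_ bn'] /(congr1 E).
  rewrite (morph_conj EM) !ERnf; try lia.
  by move=> /nfC_inj[] //; lia.
Qed.
End TypeA.

Local Open Scope nat_scope.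
Local Open Scope card_scope.

Theorem theorem5p8 :
  (forall n : nat, 1 <= n ->
    forall k : nat,
      (n = 2 * k ->
        involution_classes (coxeter_group (diagramA n)) #= `I_k) /\
      (n = 2 * k + 1 ->
        involution_classes (coxeter_group (diagramA n)) #= `I_(k + 1))) /\
  (forall n : nat, 2 <= n ->
    forall k : nat,
      (n = 2 * k ->
        involution_classes (coxeter_group (diagramC n)) #= `I_(k ^ 2 + 2 * k)) /\
      (n = 2 * k + 1 ->
        involution_classes (coxeter_group (diagramC n))
          #= `I_(k ^ 2 + 3 * k + 1))).
Proof.
split=> n _ k; split=> nk.
- have <- : n.+1./2 = k by lia.
  exact: involution_classesA_card.
- have <- : n.+1./2 = k + 1 by lia.
  exact: involution_classesA_card.
- have := involution_classesC_card n.
  by rewrite nk size_shapesC_even.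
- have := involution_classesC_card n.
  by rewrite nk size_shapesC_odd.
Qed.
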